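(* Let $\boldsymbol\alpha$ be an arbitrary sequence in $\mathbb D$, $\mu$ a measure on $\mathbb T$, $(\phi_n)_{n\ge0}$ the corresponding ORF, $\mathcal A=\mathcal A(\boldsymbol\alpha)$ and $\mathcal H=\mathcal H(\boldsymbol a)$ with $\boldsymbol a=\mathcal S_{\boldsymbol\alpha}(\mu)$. For $n\ge1$ let $\mathcal V^{(n)}=\tilde\zeta_{\mathcal A_n}(\mathcal H_n)$. Then: 1. The zeros of $\phi_n$ are the eigenvalues of $\mathcal V^{(n)}$, which have geometric multiplicity 1. If $\lambda$ is a zero of $\phi_n$, the related left eigenvectors of $\mathcal V^{(n)}$ are spanned by $\begin{pmatrix}\phi_0(\lambda)&\cdots&\phi_{n-1}(\lambda)\end{pmatrix}$. 2. $\phi_n=\dfrac{p_n}{\pi_n}$ with $p_n$ proportional to the characteristic polynomial of $\mathcal V^{(n)}$.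
   Context: $\mathbb T$ is the unit circle, $\mathbb D$ the open unit disk. A measure on $\mathbb T$ is a probability Borel measure $\mu$ on $\mathbb T$ with infinite support. $L^2_\mu$ carries the inner product $\langle f,g\rangle_\mu=\int\overline{f}\,g\,d\mu$. ORF. Let $\boldsymbol\alpha=(\alpha_n)_{n\ge1}$ be a sequence in $\mathbb D$ and set $\alpha_0=0$. For $n\ge0$ let $\varpi_n(z)=1-\overline{\alpha_n}z$, $\varpi_n^*(z)=z-\alpha_n$, $\zeta_n=\varpi_n^*/\varpi_n$; $\pi_n=\varpi_1\cdots\varpi_n$. Let $B_0=1$, $B_n=\zeta_1\cdots\zeta_n$, and $f_*(z)=\overline{f(1/\overline z)}$. The orthogonal rational functions (ORF) $(\phi_n)_{n\ge0}$ of $\mu$ associated with $\boldsymbol\alpha$ are the result of orthonormalizing $(B_n)_{n\ge0}$ in $L^2_\mu$ (so $\phi_0,\dots,\phi_n$ is an orthonormal basis of $\operatorname{span}\{B_0,\dots,B_n\}$ for every $n$), with unimodular factors chosen so that $\phi_0=1$ and, with $\phi_n^*=B_n\phi_{n*}$, $$\begin{pmatrix}\phi_n\\ \phi_n^*\end{pmatrix}=e_n\frac{\varpi_{n-1}}{\varpi_n}\begin{pmatrix}1&a_n\\ \overline{a_n}&1\end{pmatrix}\begin{pmatrix}\zeta_{n-1}\phi_{n-1}\\ \phi_{n-1}^*\end{pmatrix},\quad e_n=\sqrt{\frac{\varpi_n(\alpha_n)}{\varpi_{n-1}(\alpha_{n-1})}\frac1{1-|a_n|^2}},\quad n\ge1,$$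 for some $a_n\in\mathbb D$. This normalization exists and both $(\phi_n)$ and $\boldsymbol a=(a_n)_{n\ge1}$ are then uniquely determined; one writes $\boldsymbol a=\mathcal S_{\boldsymbol\alpha}(\mu)$. One has $\phi_n=p_n/\pi_n$ with $p_n$ a polynomial of degree $n$; the zeros of $\phi_n$ are those of $p_n$ and lie in $\mathbb D$. Matrices. $\mathcal A(\boldsymbol\alpha)=\operatorname{diag}(\alpha_0,\alpha_1,\alpha_2,\dots)$. With $\rho_n=\sqrt{1-|a_n|^2}$ and the convention $a_0=1$, $\mathcal H(\boldsymbol a)=(h_{k,n})_{k,n\ge0}$ is the Hessenberg matrix with $h_{k,n}=-a_{n+1}\rho_n\rho_{n-1}\cdots\rho_{k+1}\overline{a_k}$ for $k\le n$ (for $k=n$ the product of $\rho$'s is empty), $h_{n+1,n}=\rho_{n+1}$, and $h_{k,n}=0$ for $k>n+1$. A subscript ${}_n$ on a matrix denotes its principal submatrix of order $n$ (first $n$ rows and columns). A left eigenvector of $M$ with eigenvalue $\lambda$ is a nonzero row vector $x$ with $xM=\lambda x$. Operator Möbius transformation. For operators (matrices) $A,T$ with $\|A\|<1$, $\|T\|\le1$, set $\eta_A=\sqrt{1-AA^\dag}$ and $\tilde\zeta_A(T)=\eta_A^{-1}(T+A)(1+A^\dag T)^{-1}\eta_{A^\dag}$. *)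

(* Defs.v *)
From HB Require Import structures.
From mathcomp Require Import all_boot all_order all_algebra.
From mathcomp Require Import generic_quotient fraction.
From mathcomp Require Import sesquilinear spectral.
From mathcomp Require Import all_classical all_reals all_analysis.
From mathcomp Require Import complex.

Set Implicit Arguments.
Unset Strict Implicit.
Unset Printing Implicit Defensive.

Import Order.TTheory GRing.Theory Num.Theory numFieldNormedType.Exports.

Local Open Scope classical_set_scope.
Local Open Scope sesquilinear_scope.
Local Open Scope ring_scope.

Definition ratfun (C : numClosedFieldType) : fieldType := {fraction {poly C}}.

Definition polyrat (C : numClosedFieldType) (p : {poly C}) : ratfun C :=
  @FracField.tofrac {poly C} p.

Definition constrat (C : numClosedFieldType) (c : C) : ratfun C :=
  polyrat c%:P.

(* [repr f] is an arbitrary, not necessarily reduced, fraction representing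
   [f]: [ratnum f / ratden f] is the corresponding fraction in lowest terms. *)
Definition ratnum (C : numClosedFieldType) (f : ratfun C) : {poly C} :=
  let r := frac (repr f) in r.1 %/ gcdp r.1 r.2.

Definition ratden (C : numClosedFieldType) (f : ratfun C) : {poly C} :=
  let r := frac (repr f) in r.2 %/ gcdp r.1 r.2.

(* The value is [0], by [x / 0 = 0], when [z] is a pole. *)
Definition rateval (C : numClosedFieldType) (f : ratfun C) (z : C) : C :=
  (ratnum f).[z] / (ratden f).[z].

(* The numerator is reduced, so this never holds at a pole of [f]. *)
Definition ratzero (C : numClosedFieldType) (f : ratfun C) (z : C) : bool :=
  root (ratnum f) z.

Definition polystar (C : numClosedFieldType) (p : {poly C}) : ratfun C :=
  (map_poly (fun c : C => constrat c^*) p).[(polyrat 'X)^-1].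

(* f_*(z) = conj (f (1 / conj z)) as a rational function: conjugate the
   coefficients and substitute 1/z; independent of the chosen fraction. *)
Definition ratstar (C : numClosedFieldType) (f : ratfun C) : ratfun C :=
  let r := frac (repr f) in polystar r.1 / polystar r.2.

Definition ratspan (C : numClosedFieldType) (F : nat -> ratfun C) (n : nat)
    (f : ratfun C) : Prop :=
  exists c : nat -> C, f = \sum_(k < n.+1) constrat (c k) * F k.

Definition varpi (C : numClosedFieldType) (alpha : nat -> C) (n : nat) :
    {poly C} :=
  1 - (alpha n)^* *: 'X.

Definition varpistar (C : numClosedFieldType) (alpha : nat -> C) (n : nat) :
    {poly C} :=
  'X - (alpha n)%:P.

Definition zeta (C : numClosedFieldType) (alpha : nat -> C) (n : nat) :
    ratfun C :=
  polyrat (varpistar alpha n) / polyrat (varpi alpha n).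

Definition varpiprod (C : numClosedFieldType) (alpha : nat -> C) (n : nat) :
    {poly C} :=
  \prod_(1 <= k < n.+1) varpi alpha k.

Definition blaschke (C : numClosedFieldType) (alpha : nat -> C) (n : nat) :
    ratfun C :=
  \prod_(1 <= k < n.+1) zeta alpha k.

Definition unit_circle (R : realType) : set R[i]^o := [set z | `|z| = 1].

Definition circle (R : realType) : Type := set_type (@unit_circle R).

HB.instance Definition _ (R : realType) :=
  Topological.copy (circle R) (set_type (@unit_circle R)).

Lemma unit_circle1 (R : realType) : (1 : R[i]^o) \in @unit_circle R.
Proof. by rewrite inE /unit_circle /= normr1. Qed.

HB.instance Definition _ (R : realType) :=
  isPointed.Build (circle R) (SigSub (@unit_circle1 R)).

Definition circle_val (R : realType) (t : circle R) : R[i] := set_val t.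

Definition borel_circle (R : realType) : measurableType _ :=
  g_sigma_algebraType (@open (circle R)).

Definition msupport (R : realType) (mu : probability (borel_circle R) R) :
    set (circle R) :=
  [set t | forall U : set (circle R), open U -> U t -> (0 < mu U)%E].

Definition cintegral (R : realType) (mu : probability (borel_circle R) R)
    (f : circle R -> R[i]) : R[i] :=
  Complex (\int[mu]_t complex.Re (f t)) (\int[mu]_t complex.Im (f t)).

(* Conjugate-linear in the first argument. *)
Definition L2dot (R : realType) (mu : probability (borel_circle R) R)
    (f g : ratfun R[i]) : R[i] :=
  cintegral mu (fun t => (rateval f (circle_val t))^* *
                          rateval g (circle_val t)).

Definition orfstar (C : numClosedFieldType) (alpha : nat -> C)
    (phi : nat -> ratfun C) (n : nat) : ratfun C :=
  blaschke alpha n * ratstar (phi n).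

Definition orf_e (C : numClosedFieldType) (alpha a : nat -> C) (n : nat) : C :=
  sqrtC ((varpi alpha n).[alpha n] / (varpi alpha n.-1).[alpha n.-1]
         * (1 / (1 - `|a n| ^+ 2))).

(* [alpha] and [a] are indexed from 1. The convention [alpha 0 = 0] is assumed
   where this is used; [a 0] is irrelevant here, and only matters in [hessmx],
   where [a 0 = 1]. The recurrence is the 2x2 matrix one, row by row. *)
Record is_ORF (R : realType) (mu : probability (borel_circle R) R)
    (alpha : nat -> R[i]) (phi : nat -> ratfun R[i]) (a : nat -> R[i]) :
    Prop := IsORF {
  orf_orthonormal : forall i j : nat, L2dot mu (phi i) (phi j) = (i == j)%:R;
  orf_span : forall (n : nat) (f : ratfun R[i]),
    ratspan phi n f <-> ratspan (blaschke alpha) n f;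
  orf_phi0 : phi 0%N = 1;
  orf_param : forall n : nat, (0 < n)%N -> `|a n| < 1;
  orf_rec : forall n : nat, (0 < n)%N ->
    phi n = constrat (orf_e alpha a n)
            * (polyrat (varpi alpha n.-1) / polyrat (varpi alpha n))
            * (zeta alpha n.-1 * phi n.-1
               + constrat (a n) * orfstar alpha phi n.-1);
  orf_rec_star : forall n : nat, (0 < n)%N ->
    orfstar alpha phi n
    = constrat (orf_e alpha a n)
      * (polyrat (varpi alpha n.-1) / polyrat (varpi alpha n))
      * (constrat (a n)^* * (zeta alpha n.-1 * phi n.-1)
         + orfstar alpha phi n.-1)
}.

Definition truncmx (C : numClosedFieldType) (M : nat -> nat -> C) (n : nat) :
    'M[C]_n :=
  \matrix_(i < n, j < n) M i j.

Definition alphamx (C : numClosedFieldType) (alpha : nat -> C) (i j : nat) : C :=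
  if i == j then alpha i else 0.

Definition rho (C : numClosedFieldType) (a : nat -> C) (n : nat) : C :=
  sqrtC (1 - `|a n| ^+ 2).

Definition hessmx (C : numClosedFieldType) (a : nat -> C) (k n : nat) : C :=
  if (k <= n)%N then - a n.+1 * (\prod_(k.+1 <= j < n.+1) rho a j) * (a k)^*
  else if k == n.+1 then rho a n.+1 else 0.

(* Square root by functional calculus: [A] normal equals
   [invmx P *m diag_mx d *m P] with [P := spectralmx A] unitary and
   [d := spectral_diag A]. For [A] positive semidefinite this is its positive
   semidefinite square root. *)
Definition sqrtmx (C : numClosedFieldType) (n : nat) (A : 'M[C]_n) : 'M[C]_n :=
  invmx (spectralmx A) *m diag_mx (map_mx sqrtC (spectral_diag A))
  *m spectralmx A.

Definition etamx (C : numClosedFieldType) (n : nat) (A : 'M[C]_n) : 'M[C]_n :=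
  sqrtmx (1%:M - A *m A^t*).

Definition mobiusmx (C : numClosedFieldType) (n : nat) (A T : 'M[C]_n) :
    'M[C]_n :=
  invmx (etamx A) *m (T + A) *m invmx (1%:M + A^t* *m T) *m etamx (A^t*).

(* Main.v *)
Require Import Defs.
From HB Require Import structures.
From mathcomp Require Import all_boot all_order all_algebra.
From mathcomp Require Import all_classical all_reals all_analysis.
From mathcomp Require Import complex.
From mathcomp Require Import perm generic_quotient fraction sesquilinear spectral.
From mathcomp Require Import ring.

(** With [P_k = varpi_k phi_k / eta_k], [Q_k = varpi_k phi_k^* / eta_k] and
    [eta_k = sqrt (1 - |alpha_k|^2)], the recurrence becomes the Szego recurrence
    [rho_(k+1) P_(k+1) = zeta_k P_k + a_(k+1) Q_k] with [z] replaced by [zeta_k],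
    so that [(P_0 ... P_(n-1)) (zeta - H_n) = rho_n P_n (0 ... 0 1)].  For the
    Hessenberg matrix [zeta - H_n], this row identity gives the determinant, a
    multiple of [P_n], and the left kernel, which is at most a line.  Since
    [eta_A] and [A] are diagonal, [z - V] is, up to invertible factors,
    [varpi(z) (zeta(z) - H_n) = z (1 + A^* H_n) - (H_n + A)].  Finally
    [1 + A^* H_n] is invertible because its determinant is the coefficient of
    [z^n] in the determinant of this pencil.  That coefficient, like the values
    of the numerator of [phi_n] for [|z| >= 1], is nonzero because the recurrence
    preserves [|P| >= |Q|] and [P <> 0] there. *)

Set Implicit Arguments.
Unset Strict Implicit.
Unset Printing Implicit Defensive.

Import Order.TTheory GRing.Theory Num.Theory numFieldNormedType.Exports.
Local Open Scope classical_set_scope.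
Local Open Scope sesquilinear_scope.
Local Open Scope ring_scope.

(** * Determinant and left kernel of a Hessenberg matrix *)

(** Multiplying the row identity by [\adj M] leaves a single cofactor, that of the top right corner.
    Its minor is upper triangular, with the subdiagonal of [M] as its diagonal; the sign of the
    cofactor is spread over the factors [- M]. *)
Lemma hessenberg_det (K : comPzRingType) (n : nat) (M : 'M[K]_n.+1)
    (w : 'rV[K]_n.+1) (c : K) :
    (forall i j : 'I_n.+1, (j.+1 < i)%N -> M i j = 0) ->
    w *m M = c *: delta_mx 0 ord_max ->
  w 0 0 * \det M = c * \prod_(i < n) - M (lift ord0 i) (widen_ord (leqnSn n) i).
Proof.
move=> M0 wM; have : (w *m (M *m \adj M)) 0 ord0 = c * (\adj M) ord_max ord0.
  by rewrite mulmxA wM -scalemxAl mxE -rowE mxE.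
rewrite mul_mx_adj mul_mx_scalar mxE [_ * w _ _]mulrC => ->; congr (_ * _).
rewrite mxE /cofactor add0n; rewrite -det_tr det_trig.
  rewrite prodrN card_ord; congr (_ * _); apply: eq_bigr => i _.
  rewrite !mxE; congr (M _ _); apply: val_inj; exact: lift_max.
by apply/is_trig_mxP => i j ij; rewrite !mxE M0 // lift0 lift_max ltnS.
Qed.

(** Column [i] of [w *m M = 0] involves only the entries of [w] up to [i.+1], and the last of them
    has a nonzero coefficient, so the entries of [w] vanish one after the other. *)
Lemma hessenberg_ker0 (F : fieldType) (n : nat) (M : 'M[F]_n.+1)
    (w : 'rV[F]_n.+1) :
    (forall i j : 'I_n.+1, (j.+1 < i)%N -> M i j = 0) ->
    (forall i j : 'I_n.+1, i = j.+1 :> nat -> M i j != 0) ->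
  w *m M = 0 -> w 0 0 = 0 -> w = 0.
Proof.
move=> M0 Ms wM w0; apply/rowP => -[j]; elim/ltn_ind: j => -[|i] IH lti.
  by rewrite !mxE -[RHS]w0; congr (w _ _); apply: val_inj.
have lti' : (i < n.+1)%N by apply: ltnW.
have := congr1 (fun u : 'rV_n.+1 => u 0 (Ordinal lti')) wM; rewrite !mxE.
rewrite (bigD1 (Ordinal lti)) //= big1 => [|k kN].
  by move/eqP; rewrite addr0 mulf_eq0 (negPf (Ms _ _ _)) // orbF => /eqP.
have [ki|] := ltnP k i.+1.
  by case: k ki kN => k /= ltk ki _; rewrite IH // mxE mul0r.
rewrite leq_eqVlt => /predU1P[E|ik]; first by case/eqP: kN; apply: val_inj.
by rewrite M0 ?mulr0.
Qed.

Lemma hessenberg_ker (F : fieldType) (n : nat) (M : 'M[F]_n.+1)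
    (u x : 'rV[F]_n.+1) :
    (forall i j : 'I_n.+1, (j.+1 < i)%N -> M i j = 0) ->
    (forall i j : 'I_n.+1, i = j.+1 :> nat -> M i j != 0) ->
    u *m M = 0 -> u 0 0 != 0 -> x *m M = 0 ->
  x = (x 0 0 / u 0 0) *: u.
Proof.
move=> M0 Ms uM u0 xM; apply/eqP; rewrite -subr_eq0; apply/eqP.
apply: (hessenberg_ker0 M0 Ms).
  by rewrite mulmxBl -scalemxAl uM xM scaler0 subrr.
by rewrite !mxE divfK // subrr.
Qed.

(** * Top coefficient of the determinant of a linear pencil *)

Lemma size_prod_linear (K : comNzRingType) (I : Type) (r : seq I)
    (f : I -> {poly K}) :
  (forall i, size (f i) <= 2)%N -> (size (\prod_(i <- r) f i)%R <= (size r).+1)%N.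
Proof.
move=> f2; elim: r => [|i r IH]; first by rewrite big_nil size_poly1.
rewrite big_cons (leq_trans (size_polyMleq _ _)) // -subn1 leq_subLR /=.
by have := leq_add (f2 i) IH; rewrite !addSn.
Qed.

Lemma coef_prod_linear (K : comNzRingType) (I : Type) (r : seq I)
    (f : I -> {poly K}) :
    (forall i, size (f i) <= 2)%N ->
  (\prod_(i <- r) f i)`_(size r) = \prod_(i <- r) (f i)`_1.
Proof.
move=> f2; elim: r => [|i r IH]; first by rewrite !big_nil coef1.
(* Of the two surviving terms of the convolution, the one with the constant coefficient of [f i]
   meets a coefficient of the tail beyond its degree. *)
rewrite !big_cons -IH coefM 2!big_ord_recl [X in _ + (_ + X)]big1 => [|k _].
  rewrite subn0 subSS subn0 [X in _ * X + _]nth_default ?size_prod_linear //.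
  by rewrite mulr0 add0r addr0.
by rewrite nth_default ?mul0r // (leq_trans (f2 i)).
Qed.

(** In the Leibniz expansion every term is a product of [n] polynomials of degree at most 1, whose
    linear coefficients are entries of [G]. *)
Lemma coef_det_pencil (K : comNzRingType) (n : nat) (G N : 'M[K]_n) :
  (\det ('X *: map_mx polyC G - map_mx polyC N))`_n = \det G.
Proof.
rewrite coef_sum; apply: eq_bigr => s _.
have E : (\prod_i ('X *: map_mx polyC G - map_mx polyC N) i (s i))`_n
    = \prod_i G i (s i).
  rewrite -[X in _`_X](size_enum_ord n) -!big_enum /= coef_prod_linear.
    by apply: eq_bigr => i _; rewrite !mxE coefB coefXM !coefC subr0.
  move=> i; rewrite !mxE (leq_trans (size_polyD _ _)) // size_polyN geq_max.
  rewrite (leq_trans (size_polyC_leq1 _)) // andbT.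
  rewrite (leq_trans (size_polyMleq _ _)) //.
  by rewrite size_polyX -subn1 leq_subLR leq_add2l size_polyC_leq1.
by rewrite !mulr_sign; case: ifP; rewrite ?coefN E.
Qed.

(** * The Möbius transformation for a diagonal [A] *)

(** The diagonalizing [P] and the order of the eigenvalues are not known explicitly. But [P]
    intertwines the two diagonal matrices, so [P i j != 0] forces eigenvalue [i] to equal [d_j];
    their square roots then agree, and [P] intertwines the square roots too. *)
Lemma sqrtmx_diag (C : numClosedFieldType) (n : nat) (d : 'rV[C]_n) :
  sqrtmx (diag_mx d) = diag_mx (map_mx sqrtC d).
Proof.
set P := spectralmx (diag_mx d); have Pu : P \in unitmx by exact: spectral_unit.
have /orthomx_spectralP : diag_mx d \is normalmx.
  by apply/normalmxP; rewrite tr_diag_mx map_diag_mx diag_mxC.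
rewrite -/P => /(congr1 (mulmx P)); rewrite !mulmxA mulmxV // mul1mx => PE.
apply: (can_inj (mulKmx Pu)); rewrite /sqrtmx -/P !mulmxA mulmxV // mul1mx.
apply/matrixP => i j; have /matrixP/(_ i j) := PE.
rewrite !mul_mx_diag !mul_diag_mx !mxE.
have [-> _|Pij] := eqVneq (P i j) 0; first by rewrite mul0r mulr0.
by rewrite mulrC => /(mulIf Pij) ->; rewrite mulrC.
Qed.

Definition diagseq (C : numClosedFieldType) (f : nat -> C) (n : nat) : 'M[C]_n :=
  diag_mx (\row_(k < n) f k).

Lemma truncmx_alphamx (C : numClosedFieldType) (alpha : nat -> C) (n : nat) :
  truncmx (alphamx alpha) n = diagseq alpha n.
Proof.
apply/matrixP => i j; rewrite !mxE /alphamx.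
by rewrite (inj_eq val_inj); case: (i == j).
Qed.

Definition eta (C : numClosedFieldType) (alpha : nat -> C) (n : nat) : C :=
  sqrtC (1 - `|alpha n| ^+ 2).

Lemma etamx_diag (C : numClosedFieldType) (alpha : nat -> C) (n : nat) :
  etamx (diagseq alpha n) = diagseq (eta alpha) n.
Proof.
rewrite /etamx /diagseq tr_diag_mx map_diag_mx.
set D := (X in sqrtmx X); have -> : D = diag_mx (\row_k (1 - `|alpha k| ^+ 2)).
  apply/matrixP => i j; rewrite /D mul_diag_mx !mxE normCK.
  by case: eqVneq => [->|_]; rewrite ?mulr1n // !mulr0n mulr0 subr0.
by rewrite sqrtmx_diag; congr diag_mx; apply/rowP => i; rewrite !mxE.
Qed.

Lemma diagseq_adj (C : numClosedFieldType) (alpha : nat -> C) (n : nat) :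
  (diagseq alpha n)^t* = diagseq (fun k => (alpha k)^*) n.
Proof.
rewrite /diagseq tr_diag_mx map_diag_mx; congr diag_mx.
by apply/rowP => i; rewrite !mxE.
Qed.

Lemma eta_conj (C : numClosedFieldType) (alpha : nat -> C) :
  eta (fun k => (alpha k)^*) = eta alpha.
Proof. by apply/funext => k; rewrite /eta norm_conjC. Qed.

Lemma eta_gt0 (C : numClosedFieldType) (alpha : nat -> C) (n : nat) :
  `|alpha n| < 1 -> 0 < eta alpha n.
Proof. by move=> an; rewrite sqrtC_gt0 subr_gt0 exprn_ilt1. Qed.

Lemma diagseq_unit (C : numClosedFieldType) (f : nat -> C) (n : nat) :
  (forall k, f k != 0) -> diagseq f n \in unitmx.
Proof.
move=> f0; rewrite unitmxE det_diag unitfE; apply/prodf_neq0 => i _.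
by rewrite mxE.
Qed.

Definition mobden (C : numClosedFieldType) (n : nat) (A T : 'M[C]_n) : 'M[C]_n :=
  1%:M + A^t* *m T.

(** For diagonal [A] both eta factors are the same matrix [E]. With [G] the denominator, [N = T + A]
    and [V] the transform, [X G - N = E (X - V) E^-1 G], and the determinants of [E] cancel. *)
Lemma mobiusmx_char (C : numClosedFieldType) (n : nat) (alpha : nat -> C)
    (T : 'M[C]_n) (A := diagseq alpha n) :
    (forall k, `|alpha k| < 1) -> mobden A T \in unitmx ->
  char_poly (mobiusmx A T) * (\det (mobden A T))%:P
    = \det ('X *: map_mx polyC (mobden A T) - map_mx polyC (T + A)).
Proof.
move=> alphaD Gu; set G := mobden A T; set N := T + A.
set E := diagseq (eta alpha) n.
have Eu : E \in unitmx by apply: diagseq_unit => k; rewrite gt_eqF ?eta_gt0.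
have VE : mobiusmx A T = invmx E *m N *m invmx G *m E.
  by rewrite /mobiusmx diagseq_adj !etamx_diag eta_conj -diagseq_adj.
have GuP : map_mx polyC G \in unitmx by rewrite map_unitmx.
have EuP : map_mx polyC E \in unitmx by rewrite map_unitmx.
have -> : 'X *: map_mx polyC G - map_mx polyC N =
    map_mx polyC E *m char_poly_mx (mobiusmx A T)
      *m (map_mx polyC (invmx E) *m map_mx polyC G).
  rewrite VE /char_poly_mx !map_mxM mulmxBr mulmxBl !map_invmx !mulmxA.
  rewrite mulmxV // mul1mx mulmxK // mulmxKV //.
  by rewrite mul_mx_scalar -!scalemxAl mulmxV // mul1mx.
rewrite !det_mulmx !det_map_mx det_inv mulrA mulrAC.
by rewrite [_ * (_^-1)%:P]mulrC !mulrA -polyCM mulVr ?mul1r.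
Qed.

(** * The Szegő recurrence for the numerators *)

(** The inequality follows from [|u + x v|^2 - |x^* u + v|^2 = (1 - |x|^2) (|u|^2 - |v|^2)]. This is
    the inductive step for [orfnum_lead] and [orfnum_root]. *)
Lemma schur_step (C : numClosedFieldType) (x u v : C) :
    `|x| < 1 -> u != 0 -> `|v| <= `|u| ->
  u + x * v != 0 /\ `|x^* * u + v| <= `|u + x * v|.
Proof.
move=> x1 u0 vu; split.
  apply: contraTneq vu => /addr0_eq uxv; have v0 : v != 0.
    by apply: contraNneq u0 => v0; rewrite -oppr_eq0 uxv v0 mulr0.
  by rewrite -[`|u|]normrN uxv normrM lt_geF // gtr_pMl // normr_gt0.
rewrite -ler_sqr ?nnegrE // -subr_ge0.
have -> : `|u + x * v| ^+ 2 - `|x^* * u + v| ^+ 2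
    = (1 - `|x| ^+ 2) * (`|u| ^+ 2 - `|v| ^+ 2).
  by rewrite !normCK !rmorphD !rmorphM /= conjCK; ring.
by rewrite mulr_ge0 // subr_ge0 ?lerXn2r ?exprn_ile1 ?nnegrE // ltW.
Qed.

Section Numerators.

Variables (C : numClosedFieldType) (alpha a : nat -> C).

(* Numerators of [varpi_n phi_n / eta_n] and [varpi_n phi_n^* / eta_n] over
   [varpi_0 ... varpi_(n-1)]: in this scaling the recurrence only involves
   [1 / rho_n]. *)
Fixpoint orfnum (n : nat) : {poly C} * {poly C} :=
  if n is m.+1 then
    let u := varpistar alpha m * (orfnum m).1 in
    let v := varpi alpha m * (orfnum m).2 in
    ((rho a m.+1)^-1 *: (u + a m.+1 *: v),
     (rho a m.+1)^-1 *: ((a m.+1)^* *: u + v))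
  else (1, 1).

Local Notation s n := (orfnum n).1.
Local Notation t n := (orfnum n).2.
Local Notation w := (varpi alpha).

Hypothesis a0 : a 0%N = 1.
Hypothesis aD : forall n, (0 < n)%N -> `|a n| < 1.
Hypothesis alphaD : forall n, `|alpha n| < 1.

Lemma rho_gt0 n : (0 < n)%N -> 0 < rho a n.
Proof. by move=> n0; rewrite sqrtC_gt0 subr_gt0 exprn_ilt1 // aD. Qed.

Lemma rho_sqr n : rho a n * rho a n = 1 - a n * (a n)^*.
Proof. by rewrite -expr2 sqrtCK normCK. Qed.

Lemma orfnum_step n : (rho a n.+1)%:P * s n.+1
  = varpistar alpha n * s n + (a n.+1)%:P * (w n * t n).
Proof.
by rewrite /= mul_polyC scalerA divff ?gt_eqF ?rho_gt0 // scale1r mul_polyC.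
Qed.

(** Eliminating [varpistar alpha n * s n] between the two rows of the recurrence leaves
    [1 - |a_(n+1)|^2], which is [rho_(n+1)^2]. *)
Lemma orfnum_star_step n :
  t n.+1 = (a n.+1)^*%:P * s n.+1 + (rho a n.+1)%:P * (w n * t n).
Proof.
have r0 : rho a n.+1 != 0 by rewrite gt_eqF ?rho_gt0.
have rP0 : (rho a n.+1)%:P != 0 by rewrite polyC_eq0.
apply: (mulfI rP0); transitivity ((a n.+1)^*%:P * ((rho a n.+1)%:P * s n.+1)
    + (rho a n.+1 * rho a n.+1)%:P * (w n * t n)); last by rewrite polyCM; ring.
rewrite orfnum_step rho_sqr /= [LHS]mul_polyC scalerA divff // scale1r.
by rewrite -mul_polyC polyCB polyCM; ring.
Qed.

(** Unrolling [orfnum_star_step] yields the entries of column [j] of the Hessenberg matrix, up to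
    the factor [- a_(j+1)]. The convention [a_0 = 1] turns the initial value [t 0 = 1] into the term
    [k = 0]. *)
Lemma orfnum_star_sum j :
  t j = \sum_(k < j.+1) (\prod_(k.+1 <= i < j.+1) rho a i * (a k)^*)%:P
          * (s k * \prod_(k <= i < j) w i).
Proof.
elim: j => [|j IH].
  by rewrite big_ord1 !big_geq // a0 conjC1 !mulr1.
rewrite orfnum_star_step big_ord_recr /= [in RHS]addrC; congr (_ + _).
  by rewrite !big_geq // mul1r mulr1.
rewrite IH !mulr_sumr; apply: eq_bigr => k _.
have kj : (k <= j)%N by rewrite -ltnS.
rewrite [in RHS]big_nat_recr // [\prod_(k <= i < j.+1) w i]big_nat_recr //.
by rewrite !polyCM /=; ring.
Qed.

(** * The Hessenberg pencil and its row identity *)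

(** This is [zeta - H_n] with row [i] multiplied by [varpi_i], which makes the entries
    polynomials. *)
Definition pencil n : 'M[{poly C}]_n :=
  \matrix_(i, j) ((i == j)%:R * varpistar alpha i - w i * (hessmx a i j)%:P).

(** These are the functions [phi_k / eta_k] multiplied by the common denominator
    [varpi_1 ... varpi_(n-1)]. *)
Definition orfrow n : 'rV[{poly C}]_n :=
  \row_k (s k * \prod_(k.+1 <= i < n) w i).

(** In column [j] the diagonal and the entries above it give [rho_(j+1) s_(j+1)], by the recurrence,
    up to a product of [varpi_i]. The subdiagonal entry cancels this in every column but the
    last. *)
Lemma orfrow_pencil n : orfrow n.+1 *m pencil n.+1
  = ((rho a n.+1)%:P * s n.+1) *: delta_mx 0 ord_max.
Proof.
apply/rowP => j; rewrite !mxE.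
pose F k : {poly C} := s k * \prod_(k <= i < n.+1) w i * (hessmx a k j)%:P.
have E : \sum_k orfrow n.+1 0 k * pencil n.+1 k j =
    s j * \prod_(j.+1 <= i < n.+1) w i * varpistar alpha j - \sum_(k < n.+1) F k.
  rewrite (eq_bigr (fun k => (k == j)%:R * (s k * \prod_(k.+1 <= i < n.+1) w i
       * varpistar alpha k) - F k)); last first.
    move=> k _; rewrite !mxE /F [\prod_(k <= i < _) _]big_ltn ?ltn_ord //.
    by ring.
  rewrite sumrB (bigD1 j) //= eqxx mul1r [X in _ + X - _]big1 ?addr0 //.
  by move=> k /negPf->; rewrite mul0r.
rewrite E; have jn := ltn_ord j.
(* On and above the diagonal, [- a_(j+1)] factors out and the remaining sum is [t j]. *)
have Fsum : \sum_(k < j.+1) F k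
    = - (a j.+1)%:P * (w j * t j) * \prod_(j.+1 <= i < n.+1) w i.
  rewrite orfnum_star_sum mulr_sumr mulr_sumr mulr_suml; apply: eq_bigr => k _.
  have kj : (k <= j)%N by rewrite -ltnS.
  rewrite /F /hessmx kj (big_cat_nat kj (ltnW jn)) /=.
  rewrite [X in _ * (_ * X) * _]big_ltn //.
  by rewrite !polyCM polyCN; ring.
(* The last column has no subdiagonal entry, so nothing cancels there. *)
have [jlt|] := ltnP j n; last first.
  move=> nj; have jn' : j = n :> nat by apply/eqP; rewrite eqn_leq nj andbT -ltnS.
  have -> : j = ord_max by apply: val_inj.
  rewrite !eqxx mulr1 orfnum_step.
  have := Fsum; rewrite jn' => ->; rewrite !big_geq //=.
  by ring.
have -> : (j == ord_max) = false by rewrite -(inj_eq val_inj) /= ltn_eqF.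
have -> : \sum_(k < n.+1) F k = \sum_(k < j.+1) F k + F j.+1.
  rewrite -(big_mkord xpredT F) (@big_cat_nat _ _ _ j.+2) //=.
  rewrite [X in _ + X]big_nat [X in _ + X]big1 ?addr0 => [|k /andP[jk _]].
    by rewrite big_nat_recr //= big_mkord.
  by rewrite /F /hessmx leqNgt (ltnW jk) gtn_eqF // mulr0.
rewrite Fsum /F /hessmx ltnn eqxx andbF mulr0; apply/eqP; rewrite subr_eq0.
apply/eqP; rewrite -mulrA [X in _ + X]mulrC [X in _ = _ + X]mulrA orfnum_step.
by ring.
Qed.

(** * Degrees of the numerators and location of their zeros *)

Lemma size_orfnum n : (size (s n) <= n.+1)%N /\ (size (t n) <= n.+1)%N.
Proof.
elim: n => [|n [IHs IHt]]; first by rewrite size_poly1.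
have sM (p q : {poly C}) :
    (size p <= 2 -> size q <= n.+1 -> size (p * q)%R <= n.+2)%N.
  move=> p2 qn; rewrite (leq_trans (size_polyMleq _ _)) // -subn1 leq_subLR.
  by have := leq_add p2 qn; rewrite !addSn.
have u2 : (size (varpistar alpha n * s n)%R <= n.+2)%N.
  by rewrite sM // size_XsubC.
have v2 : (size (w n * t n)%R <= n.+2)%N.
  rewrite sM // (leq_trans (size_polyD _ _)) // size_poly1 size_polyN geq_max /=.
  by rewrite (leq_trans (size_scale_leq _ _)) // size_polyX.
rewrite /=; split; rewrite (leq_trans (size_scale_leq _ _)) //;
  rewrite (leq_trans (size_polyD _ _)) // geq_max ?u2 ?v2 ?andbT //=;
  by rewrite (leq_trans (size_scale_leq _ _)).
Qed.

(** This is the case [z = infinity] of [orfnum_root]: the coefficients of [z^n] replace the values,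
    and multiplication by [varpi_n] contributes [- (alpha_n)^*], of modulus less than 1. *)
Lemma orfnum_lead n : (s n)`_n != 0 /\ `|(t n)`_n| <= `|(s n)`_n|.
Proof.
elim: n => [|n [sn0 tsn]]; first by rewrite coef1 oner_eq0.
have [sz tz] := size_orfnum n.
have r0 : (rho a n.+1)^-1 != 0 by rewrite invr_eq0 gt_eqF ?rho_gt0.
have uE : (varpistar alpha n * s n)`_n.+1 = (s n)`_n.
  by rewrite mulrBl coefB coefXM coefCM [X in _ * X]nth_default // mulr0 subr0.
have vE : (w n * t n)`_n.+1 = - (alpha n)^* * (t n)`_n.
  rewrite mulrBl mul1r -scalerAl coefB coefZ coefXM.
  rewrite [X in X - _]nth_default // sub0r.
  by rewrite mulNr.
have vu : `|- (alpha n)^* * (t n)`_n| <= `|(s n)`_n|.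
  rewrite normrM normrN norm_conjC (le_trans _ tsn) // ler_piMl //.
  exact/ltW.
have [] := schur_step (aD (ltn0Sn n)) sn0 vu => nz le.
rewrite /= !coefZ !coefD !coefZ uE vE mulf_neq0 //; split=> //.
by rewrite !normrM ler_wpM2l.
Qed.

(** Outside the open disk [|varpi_n(z)| <= |z - alpha_n|], so [schur_step] applies to the two
    products in the recurrence. *)
Lemma orfnum_root n z :
  1 <= `|z| -> (s n).[z] != 0 /\ `|(t n).[z]| <= `|(s n).[z]|.
Proof.
move=> z1; elim: n => [|n [sn0 tsn]]; first by rewrite hornerC oner_eq0.
have r0 : (rho a n.+1)^-1 != 0 by rewrite invr_eq0 gt_eqF ?rho_gt0.
have u0 : (varpistar alpha n * s n).[z] != 0.
  rewrite hornerM mulf_neq0 // hornerXsubC subr_eq0.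
  by apply: contraTneq z1 => ->; rewrite lt_geF.
have vu : `|(w n * t n).[z]| <= `|(varpistar alpha n * s n).[z]|.
  rewrite !hornerM !normrM ler_pM // -ler_sqr ?nnegrE // -subr_ge0.
  rewrite !hornerE !normCK.
  rewrite !rmorphB !rmorphM /= conjCK rmorph1.
  have -> : (z - alpha n) * (z^* - (alpha n)^*)
      - (1 - (alpha n)^* * z) * (1 - alpha n * z^*)
      = (z * z^* - 1) * (1 - alpha n * (alpha n)^*) by ring.
  by rewrite -!normCK mulr_ge0 // subr_ge0 ?exprn_ege1 // exprn_ile1 // ltW.
have [nz le] := schur_step (aD (ltn0Sn n)) u0 vu.
rewrite /= ![(_ *: _).[z]]hornerZ ![(_ + _).[z]]hornerD ![(_ *: _).[z]]hornerZ.
split; first by rewrite mulf_neq0.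
by rewrite !normrM ler_wpM2l.
Qed.

Lemma orfnum_root_disk n z : root (s n) z -> `|z| < 1.
Proof.
move=> rz; rewrite real_ltNge ?normr_real ?real1 //; apply/negP => z1.
by have [/negP[]] := orfnum_root n z1.
Qed.

(** * Characteristic polynomial and left eigenvectors *)

Lemma varpi_neq0 n z : `|z| < 1 -> (w n).[z] != 0.
Proof.
move=> z1; rewrite !hornerE subr_eq0 eq_sym.
apply: contraTneq (z1) => /(congr1 Num.norm).
rewrite normrM norm_conjC normr1 => E.
by rewrite le_gtF // -E ler_piMl // ltW.
Qed.

Lemma prod_varpi_neq0 m n z : `|z| < 1 -> (\prod_(m <= i < n) w i).[z] != 0.
Proof.
move=> z1; rewrite horner_prod prodf_seq_neq0.
by apply/allP => i _; rewrite varpi_neq0.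
Qed.

Lemma prod_rho_neq0 n : \prod_(1 <= i < n.+1) rho a i != 0.
Proof.
rewrite prodf_seq_neq0; apply/allP => i; rewrite mem_index_iota => /andP[i0 _].
by rewrite gt_eqF ?rho_gt0.
Qed.

Lemma pencil_hess n (i j : 'I_n) : (j.+1 < i)%N -> pencil n i j = 0.
Proof.
move=> ji; rewrite mxE /hessmx leqNgt (ltnW ji) gtn_eqF // mulr0 subr0.
by rewrite -(inj_eq val_inj) gtn_eqF ?mul0r // ltnW.
Qed.

Lemma pencil_subdiag n (i j : 'I_n) :
  i = j.+1 :> nat -> pencil n i j = - (rho a i)%:P * w i.
Proof.
move=> ij; rewrite mxE /hessmx -(inj_eq val_inj) /= ij ltnn eqxx gtn_eqF //.
by rewrite mul0r sub0r mulNr mulrC.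
Qed.

Lemma det_pencil n :
  \det (pencil n.+1) = (\prod_(1 <= i < n.+2) rho a i)%:P * s n.+1.
Proof.
have := hessenberg_det (@pencil_hess n.+1) (orfrow_pencil n).
rewrite (eq_bigr (fun i : 'I_n => (rho a i.+1)%:P * w i.+1)); last first.
  by move=> i _; rewrite pencil_subdiag ?lift0 // mulNr opprK.
rewrite big_split /= mxE /= mul1r -rmorph_prod.
rewrite -(big_mkord xpredT (fun i => rho a i.+1)).
rewrite -(big_mkord xpredT (fun i => w i.+1)) -!(big_add1 _ _ 0 n.+1 xpredT).
(* This product is both the first entry of [orfrow] and a factor of the subdiagonal product, so it
   cancels; it takes a nonzero value at 0. *)
have w0 : \prod_(1 <= i < n.+1) w i != 0.
  apply: contraTneq isT => w0; have := @prod_varpi_neq0 1 n.+1 0.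
  by rewrite normr0 ltr01 w0 horner0 eqxx => /(_ isT).
move=> E; apply: (mulfI w0); rewrite E.
rewrite [\prod_(1 <= i < n.+2) rho a i]big_nat_recr //= polyCM.
by ring.
Qed.

Lemma pencilE n (H := truncmx (hessmx a) n) (A := diagseq alpha n) :
  pencil n = 'X *: map_mx polyC (mobden A H) - map_mx polyC (H + A).
Proof.
rewrite /mobden diagseq_adj /diagseq mul_diag_mx.
apply/matrixP => i j; rewrite !mxE.
rewrite /varpi /varpistar -mul_polyC.
by case: eqVneq => [->|_];
  rewrite ?mulr1n ?mulr0n !(polyCD, polyCM, polyC0, polyC1); ring.
Qed.

(** This makes the [invmx] in [mobiusmx] a genuine inverse, since [invmx] returns a singular matrix
    unchanged. *)
Lemma mobden_unit n (n0 : (0 < n)%N) (H := truncmx (hessmx a) n) :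
  mobden (diagseq alpha n) H \in unitmx.
Proof.
rewrite unitmxE unitfE -(coef_det_pencil _ (H + diagseq alpha n)) -pencilE.
case: n n0 @H => // n _ _; rewrite det_pencil coefCM mulf_neq0 ?prod_rho_neq0 //.
by have [] := orfnum_lead n.+1.
Qed.

Lemma char_poly_orfnum n (n0 : (0 < n)%N) (H := truncmx (hessmx a) n)
    (A := diagseq alpha n) :
  exists2 c : C, c != 0 & s n = c *: char_poly (mobiusmx A H).
Proof.
(* Constant obtained by comparing the two values of the determinant of the pencil, in
   [mobiusmx_char] and [det_pencil]. *)
exists (\det (mobden A H) / \prod_(1 <= i < n.+1) rho a i).
  rewrite mulf_neq0 ?invr_eq0 ?prod_rho_neq0 //.
  have : mobden A H \in unitmx by exact: mobden_unit.
  by rewrite unitmxE unitfE.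
have := mobiusmx_char alphaD (mobden_unit n0); rewrite -pencilE.
case: n n0 @H @A => // n _ H A; rewrite det_pencil => E.
have rP0 : (\prod_(1 <= i < n.+2) rho a i)%:P != 0.
  by rewrite polyC_eq0 prod_rho_neq0.
apply: (mulfI rP0); rewrite -E -mul_polyC mulrA -polyCM mulrCA divff ?mulr1 //.
  by rewrite mulrC.
exact: prod_rho_neq0.
Qed.

(** The factorization behind [mobiusmx_char], at a point [z]: the map [x -> x E^-1] carries left
    eigenvectors of the transform to the left kernel of the pencil. *)
Lemma mobiusmx_eigen n z (x : 'rV[C]_n) (A := diagseq alpha n) (T : 'M[C]_n) :
    mobden A T \in unitmx ->
  x *m mobiusmx A T = z *: x <->
  x *m invmx (etamx A) *m (z *: mobden A T - (T + A)) = 0.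
Proof.
set G := mobden A T => Gu; set N := T + A.
have Eu : etamx A \in unitmx.
  by rewrite etamx_diag diagseq_unit // => k; rewrite gt_eqF ?eta_gt0.
have VE : mobiusmx A T = invmx (etamx A) *m N *m invmx G *m etamx A.
  by rewrite /mobiusmx diagseq_adj !etamx_diag eta_conj -diagseq_adj.
move: (etamx A) Eu VE => E Eu VE.
have -> : x *m invmx E *m (z *: G - N)
    = (z *: x - x *m mobiusmx A T) *m (invmx E *m G).
  rewrite VE mulmxBr mulmxBl -!scalemxAr -!scalemxAl !mulmxA.
  by rewrite mulmxK // mulmxKV.
split=> [->|/(congr1 (mulmxr (invmx (invmx E *m G))))].
  by rewrite subrr mul0mx.
rewrite /= mulmxK ?unitmx_mul ?unitmx_inv ?Eu // mul0mx => /eqP.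
by rewrite subr_eq0 => /eqP.
Qed.

(** At a root of [s n] the right-hand side of [orfrow_pencil] vanishes, so the evaluated row lies in
    the left kernel of the pencil. Its subdiagonal is nonzero in the disk, hence that kernel is a
    line. The row [v] will be that of the values [phi_k(z)]. *)
Lemma mobiusmx_eigenspace n z (n0 : (0 < n)%N) (H := truncmx (hessmx a) n)
    (A := diagseq alpha n)
    (v := \row_(k < n) (eta alpha k * (s k).[z] / (varpiprod alpha k).[z])) :
    `|z| < 1 -> root (s n) z ->
  (eigenspace (mobiusmx A H) z :=: v)%MS /\ v != 0.
Proof.
case: n n0 @H @A @v => // n _ H A v z1 rz.
pose M := map_mx (horner_eval z) (pencil n.+1).
have ME : M = z *: mobden A H - (H + A).
  rewrite /M pencilE map_mxB map_mxZ /= /horner_eval hornerX -!map_mx_comp.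
  by congr (_ *: _ - _); apply/matrixP => i j; rewrite mxE /= hornerC.
have Gu : mobden A H \in unitmx by exact: mobden_unit.
pose E := etamx A; pose u := v *m invmx E.
have Eu : E \in unitmx.
  by rewrite /E etamx_diag diagseq_unit // => k; rewrite gt_eqF ?eta_gt0.
have w0 k : (varpiprod alpha k).[z] != 0 by exact: prod_varpi_neq0.
have uE : u = (varpiprod alpha n).[z]^-1 *: map_mx (horner_eval z) (orfrow n.+1).
  rewrite /u; apply: (can_inj (mulmxK Eu)); rewrite mulmxKV // /E etamx_diag.
  apply/rowP => k; rewrite mul_mx_diag !mxE /horner_eval hornerM.
  have kn : (k <= n)%N by rewrite -ltnS.
  have wE : (varpiprod alpha n).[z]
      = (varpiprod alpha k).[z] * (\prod_(k.+1 <= i < n.+1) w i).[z].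
    by rewrite -hornerM /varpiprod -big_cat_nat.
  have wk : (\prod_(k.+1 <= i < n.+1) w i).[z] != 0 by exact: prod_varpi_neq0.
  by rewrite wE; field; rewrite w0 wk.
have uM : u *m M = 0.
  rewrite uE -scalemxAl -map_mxM orfrow_pencil map_mxZ /= /horner_eval hornerM.
  by rewrite (rootP rz) mulr0 scale0r scaler0.
(* The first entry is nonzero because [s 0 = 1] and the [varpi_i] do not vanish in the disk. *)
have u0 : u 0 0 != 0.
  rewrite uE !mxE /horner_eval /= mul1r mulf_neq0 ?invr_eq0 //.
  exact: prod_varpi_neq0.
have v0 : v != 0.
  by apply: contraNneq u0 => v0; rewrite /u v0 mul0mx mxE.
split=> //; apply/eqmxP/andP; split; last first.
  by apply/eigenspaceP; rewrite ME in uM; exact/(mobiusmx_eigen z v Gu).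
apply/row_subP => i; set x := row i _.
have /eigenspaceP : (x <= eigenspace (mobiusmx A H) z)%MS by exact: row_sub.
move/(mobiusmx_eigen z x Gu); rewrite -/E -ME => xM.
have xE : x *m invmx E = ((x *m invmx E) 0 0 / u 0 0) *: u.
  apply: hessenberg_ker uM u0 xM => k l kl.
    by rewrite mxE pencil_hess // /horner_eval horner0.
  rewrite mxE pencil_subdiag // /horner_eval hornerM hornerN hornerC mulf_neq0 //.
    by rewrite oppr_eq0 gt_eqF // rho_gt0 // kl.
  exact: varpi_neq0.
have -> : x = (x *m invmx E *m E) by rewrite mulmxKV.
by rewrite xE -scalemxAl mulmxKV // scalemx_sub.
Qed.

End Numerators.

(** * Values and zeros of rational functions *)

Lemma ratfun_frac (C : numClosedFieldType) (f : ratfun C) :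
  f = polyrat (frac (repr f)).1 / polyrat (frac (repr f)).2.
Proof.
set r := repr f.
rewrite -[LHS]reprK -/r /polyrat; unlock FracField.tofrac.
rewrite -[X in _ * X]FracField.pi_inv -[RHS]FracField.pi_mul.
rewrite /FracField.mulf /FracField.invf !numden_Ratio ?oner_eq0 ?denom_ratioP //.
by rewrite mulr1 mul1r Ratio_numden.
Qed.

(** Cross-multiplication compares the reduced form with any explicit fraction, whatever
    representative [repr f] is. *)
Lemma ratnum_cross (C : numClosedFieldType) (f : ratfun C) (p q : {poly C}) :
  q != 0 -> f = polyrat p / polyrat q -> ratnum f * q = p * ratden f.
Proof.
move=> q0 fE; rewrite /ratnum /ratden; set r := repr f; set g := gcdp _ _.
have r2 : (frac r).2 != 0 by exact: denom_ratioP.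
have rE : f = polyrat (frac r).1 / polyrat (frac r).2 by exact: ratfun_frac.
have : (frac r).1 * q = p * (frac r).2.
  apply/eqP; rewrite -tofrac_eq !tofracM; apply/eqP.
  have rP : polyrat (frac r).2 != 0 by rewrite tofrac_eq0.
  have qP : polyrat q != 0 by rewrite tofrac_eq0.
  by move: fE; rewrite rE => /eqP; rewrite eqr_div // => /eqP ->.
have g0 : g != 0 by rewrite gcdp_eq0 negb_and r2 orbT.
move=> E; apply: (mulIf g0).
by rewrite mulrAC -[RHS]mulrA !divpK ?dvdp_gcdl ?dvdp_gcdr.
Qed.

Lemma ratnum_coprime (C : numClosedFieldType) (f : ratfun C) :
  coprimep (ratnum f) (ratden f).
Proof.
rewrite /ratnum /ratden coprimep_div_gcd //.
by rewrite orbC; apply/orP; left; exact: denom_ratioP.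
Qed.

Lemma coprimep_horner (C : fieldType) (p q : {poly C}) z :
  coprimep p q -> (p.[z] != 0) || (q.[z] != 0).
Proof.
move=> cpq; rewrite -negb_and; apply/negP => /andP[/eqP pz /eqP qz].
have [[u v] /= e] := Bezout_eq1_coprimepP _ _ cpq.
have /(congr1 (horner^~ z)) := e.
rewrite /= hornerD !hornerM pz qz !mulr0 addr0 hornerC => /eqP.
by rewrite eq_sym oner_eq0.
Qed.

(** At [z], neither the pair [p], [q] nor the reduced pair vanishes simultaneously, so the
    cross-multiplied identity transfers the vanishing of one numerator to the other. *)
Lemma ratzeroE (C : numClosedFieldType) (p q : {poly C}) z :
    q != 0 -> (p.[z] != 0) || (q.[z] != 0) ->
  ratzero (polyrat p / polyrat q) z = root p z.
Proof.
move=> q0 pqz; set f := _ / _.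
have := congr1 (horner^~ z) (ratnum_cross q0 (erefl f)); rewrite /= !hornerM => E.
have := coprimep_horner z (ratnum_coprime f).
rewrite /ratzero /root => nd; apply/eqP/eqP => [n0|p0].
  rewrite n0 eqxx /= in nd; move/eqP: E.
  by rewrite n0 mul0r eq_sym mulf_eq0 (negPf nd) orbF => /eqP.
move/eqP: E; rewrite p0 mul0r mulf_eq0; move: pqz; rewrite p0 eqxx /=.
by move/negPf->; rewrite orbF => /eqP.
Qed.

Lemma ratevalE (C : numClosedFieldType) (p q : {poly C}) z :
  q.[z] != 0 -> rateval (polyrat p / polyrat q) z = p.[z] / q.[z].
Proof.
move=> qz; set f := _ / _.
have q0 : q != 0 by apply: contraNneq qz => ->; rewrite horner0.
have := congr1 (horner^~ z) (ratnum_cross q0 (erefl f)); rewrite /= !hornerM => E.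
have nd := coprimep_horner z (ratnum_coprime f).
have d0 : (ratden f).[z] != 0.
  apply: contraTneq nd => d0; rewrite d0 eqxx orbF negbK.
  by move/eqP: E; rewrite d0 mulr0 mulf_eq0 (negPf qz) orbF.
by apply/eqP; rewrite /rateval eqr_div // E.
Qed.

(* [polystar p * 'X^(deg p)] is the reversed conjugate polynomial of [p], whose
   constant term is the conjugate of the leading coefficient of [p]. *)
Lemma polystar_neq0 (C : numClosedFieldType) (p : {poly C}) :
  p != 0 -> polystar p != 0.
Proof.
move=> p0; set d := (size p).-1; have sp : size p = d.+1 by exact: polySpred.
have X0 : polyrat 'X != 0 :> ratfun C by rewrite tofrac_eq0 polyX_eq0.
pose q := \sum_(i < d.+1) (p`_i)^* *: 'X^(d - i) : {poly C}.
have E : polystar p * polyrat 'X ^+ d = polyrat q.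
  rewrite /polystar (@horner_coef_wide _ d.+1) -?sp ?size_poly // sp mulr_suml.
  rewrite /q /polyrat rmorph_sum; apply: eq_bigr => i _ /=.
  rewrite coef_poly sp ltn_ord -mul_polyC rmorphM /= rmorphXn /= -mulrA.
  have -> : FracField.tofrac 'X ^+ d
      = FracField.tofrac 'X ^+ i * FracField.tofrac 'X ^+ (d - i) :> ratfun C.
    by rewrite -exprD subnKC // -ltnS.
  by congr (_ * _); rewrite mulrA -exprMn mulVf // expr1n mul1r.
have q0 : q`_0 != 0.
  rewrite coef_sum big_ord_recr /= big1 ?add0r => [|k _].
    by rewrite subnn coefZ coef1 mulr1 conjC_eq0 -lead_coefE lead_coef_eq0.
  by rewrite coefZ coefXn eq_sym subn_eq0 leqNgt ltn_ord mulr0.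
apply: contraNneq q0 => p'0; move: E; rewrite p'0 mul0r => /esym/eqP.
by rewrite tofrac_eq0 => /eqP->; rewrite coef0.
Qed.

(** * From the ORF recurrence to the numerators *)

(** The representative of 1 is some [p / p], so its image is 1 once [polystar p] is nonzero. This
    gives [phi_0^* = 1]. *)
Lemma ratstar1 (C : numClosedFieldType) : ratstar (1 : ratfun C) = 1.
Proof.
rewrite /ratstar; set r := frac _.
have r2 : r.2 != 0 by exact: denom_ratioP.
have /esym/divr1_eq/eqP := ratfun_frac (1 : ratfun C).
by rewrite -/r tofrac_eq => /eqP ->; rewrite divff // polystar_neq0.
Qed.

(** Since [varpi_k(alpha_k) = eta_k^2], the radicand is the square of a nonnegative number. The
    ratio of etas is absorbed by the scaling of [orfnum]. *)
Lemma orf_eE (C : numClosedFieldType) (alpha a : nat -> C) n :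
    (forall n, `|alpha n| < 1) -> `|a n.+1| < 1 ->
  orf_e alpha a n.+1 = eta alpha n.+1 / (eta alpha n * rho a n.+1).
Proof.
move=> alphaD an.
have wE k : (varpi alpha k).[alpha k] = eta alpha k ^+ 2.
  by rewrite !hornerE sqrtCK normCK mulrC.
have rE : 1 - `|a n.+1| ^+ 2 = rho a n.+1 ^+ 2 by rewrite sqrtCK.
rewrite /orf_e !wE rE /= mul1r -!exprVn -!exprMn sqrCK ?invfM ?mulrA //.
by rewrite !mulr_ge0 ?invr_ge0 ?ltW ?eta_gt0 // sqrtC_gt0 subr_gt0 exprn_ilt1.
Qed.

Lemma varpi_poly_neq0 (C : numClosedFieldType) (alpha : nat -> C) n :
  varpi alpha n != 0.
Proof.
have w1 : (varpi alpha n).[0] = 1 by rewrite !hornerE ?mulr0 ?subr0.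
by apply: contra_eq_neq w1 => ->; rewrite horner0 eq_sym oner_eq0.
Qed.

Lemma varpiprod_neq0 (C : numClosedFieldType) (alpha : nat -> C) n :
  varpiprod alpha n != 0.
Proof. by rewrite prodf_seq_neq0; apply/allP => i _; exact: varpi_poly_neq0. Qed.

(** Both rows of the recurrence at once: [(x, y)] is [(1, a_n)] for [phi_n] and [((a_n)^*, 1)] for
    [phi_n^*]. *)
Lemma orf_rec_numerators (K : fieldType) (e1 e r w w1 ws P s t x y : K) :
    e != 0 -> r != 0 -> w != 0 -> w1 != 0 -> P != 0 ->
  e1 / (e * r) * (w / w1) * (x * (ws / w * (e * s / P)) + y * (e * t / P))
    = e1 * (r^-1 * (x * (ws * s) + y * (w * t))) / (P * w1).
Proof. by move=> e0 r0 w0 w10 P0; field; rewrite e0 r0 w0 w10 P0. Qed.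

Lemma mobiusmx_orf (C : numClosedFieldType) (alpha a : nat -> C)
    (phi : nat -> ratfun C) (n : nat) :
    a 0%N = 1 -> (forall k, (0 < k)%N -> `|a k| < 1) ->
    (forall k, `|alpha k| < 1) ->
    (forall k, phi k = polyrat (eta alpha k *: (orfnum alpha a k).1)
                         / polyrat (varpiprod alpha k)) ->
    (0 < n)%N ->
  let V := mobiusmx (truncmx (alphamx alpha) n) (truncmx (hessmx a) n) in
  ((forall z, ratzero (phi n) z <-> eigenvalue V z) /\
   (forall z, eigenvalue V z -> \rank (eigenspace V z) = 1%N) /\
   (forall z, ratzero (phi n) z ->
      (eigenspace V z :=: \row_(k < n) rateval (phi k) z)%MS)) /\
  (exists p, phi n = polyrat p / polyrat (varpiprod alpha n) /\
     exists c, c != 0 /\ p = c *: char_poly V).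
Proof.
move=> a0 aD alphaD phiE n0 V.
have e0 k : eta alpha k != 0 by rewrite gt_eqF ?eta_gt0.
have VE : V = mobiusmx (diagseq alpha n) (truncmx (hessmx a) n).
  by rewrite /V truncmx_alphamx.
have [d d0 sE] : exists2 c, c != 0 & (orfnum alpha a n).1 = c *: char_poly V.
  by rewrite VE; exact: char_poly_orfnum.
have zeroE z : ratzero (phi n) z = root (orfnum alpha a n).1 z.
  rewrite phiE ratzeroE ?varpiprod_neq0 //; first by rewrite rootZ.
  (* A root of the numerator lies in the disk, where the denominator does not vanish; hence no
     cancellation can remove a zero. *)
  have [rz|nz] := boolP (root (orfnum alpha a n).1 z).
    rewrite (prod_varpi_neq0 alphaD) ?orbT //.
    exact: orfnum_root_disk aD alphaD _ _ rz.
  by rewrite hornerZ mulf_neq0.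
have eigE z : eigenvalue V z = ratzero (phi n) z.
  by rewrite zeroE eigenvalue_root_char sE rootZ.
have space z : ratzero (phi n) z ->
    (eigenspace V z :=: \row_(k < n) rateval (phi k) z)%MS /\
    \row_(k < n) rateval (phi k) z != 0.
  rewrite zeroE => rz; have z1 := orfnum_root_disk aD alphaD rz.
  have -> : \row_(k < n) rateval (phi k) z = \row_(k < n)
      (eta alpha k * (orfnum alpha a k).1.[z] / (varpiprod alpha k).[z]).
    apply/rowP => k; rewrite !mxE phiE ratevalE ?hornerZ //.
    exact: (prod_varpi_neq0 alphaD).
  by rewrite VE; exact: mobiusmx_eigenspace.
split; first split=> [z|]; [by rewrite eigE | split=> z | ].
- by rewrite eigE => /space[-> v0]; rewrite rank_rV v0.
- by move=> /space[].
exists (eta alpha n *: (orfnum alpha a n).1); split=> //.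
by exists (eta alpha n * d); rewrite mulf_neq0 // sE scalerA.
Qed.

Lemma orf_numerators (R : realType) (mu : probability (borel_circle R) R)
    (alpha : nat -> R[i]) (phi : nat -> ratfun R[i]) (a : nat -> R[i]) :
    alpha 0%N = 0 -> (forall n, `|alpha n| < 1) -> is_ORF mu alpha phi a ->
  forall n,
    phi n = polyrat (eta alpha n *: (orfnum alpha a n).1)
              / polyrat (varpiprod alpha n) /\
    orfstar alpha phi n = polyrat (eta alpha n *: (orfnum alpha a n).2)
                            / polyrat (varpiprod alpha n).
Proof.
move=> alpha0 alphaD [_ _ phi0 aD rec recs]; elim=> [|n [IH1 IH2]].
  (* Here [alpha_0 = 0] gives [eta_0 = 1], matching [phi_0 = 1]. *)
  rewrite /orfstar phi0 ratstar1 /blaschke /varpiprod !big_geq //= /eta alpha0.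
  by rewrite normr0 expr0n subr0 sqrtC1 scale1r /polyrat tofrac1 mulr1 divr1.
rewrite (rec n.+1) // (recs n.+1) // [n.+1.-1]/= IH1 IH2 orf_eE ?aD //.
have r0 : rho a n.+1 != 0.
  by rewrite gt_eqF // sqrtC_gt0 subr_gt0 exprn_ilt1 // aD.
have e0 k : eta alpha k != 0 by rewrite gt_eqF ?eta_gt0.
have pM p q : polyrat (p * q) = polyrat p * polyrat q :> ratfun R[i].
  by exact: tofracM.
have pD p q : polyrat (p + q) = polyrat p + polyrat q :> ratfun R[i].
  by exact: tofracD.
have p0 p : p != 0 -> polyrat p != 0 :> ratfun R[i] by rewrite tofrac_eq0.
have c0 c : c != 0 -> polyrat c%:P != 0 :> ratfun R[i].
  by move=> c0; rewrite p0 // polyC_eq0.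
have pV c : c != 0 -> polyrat (c^-1)%:P = (polyrat c%:P)^-1 :> ratfun R[i].
  move=> cn0; apply: (mulfI (c0 c cn0)); rewrite mulfV ?c0 //.
  by rewrite -pM -polyCM divff //; exact: tofrac1.
have PE : varpiprod alpha n.+1 = varpiprod alpha n * varpi alpha n.+1.
  by rewrite /varpiprod big_nat_recr.
rewrite /constrat /zeta PE /= -!mul_polyC.
move: (varpi_poly_neq0 alpha n) (varpi_poly_neq0 alpha n.+1).
move: (varpiprod_neq0 alpha n).
move: (orfnum alpha a n).1 (orfnum alpha a n).2.
move: (varpi alpha n) (varpi alpha n.+1).
move: (varpistar alpha n) (varpiprod alpha n) => ws P w w1 sn tn Pn0 wn0 w1n0.
rewrite !(polyCM, pM, pD) !pV ?mulf_neq0 // polyCM pM.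
have recE x y := orf_rec_numerators (polyrat (eta alpha n.+1)%:P) (polyrat ws)
  (polyrat sn) (polyrat tn) x y (c0 _ (e0 n)) (c0 _ r0) (p0 _ wn0) (p0 _ w1n0)
  (p0 _ Pn0).
split.
  by have := recE 1 (polyrat (a n.+1)%:P); rewrite !mul1r.
by have := recE (polyrat (a n.+1)^*%:P) 1; rewrite !mul1r.
Qed.

Theorem theorem4p5 (R : realType) (alpha : nat -> R[i])
    (alpha0 : alpha 0%N = 0)
    (alphaD : forall n : nat, (0 < n)%N -> `|alpha n| < 1)
    (mu : probability (borel_circle R) R)
    (mu_inf : infinite_set (msupport mu))
    (phi : nat -> ratfun R[i]) (a : nat -> R[i])
    (phi_ORF : is_ORF mu alpha phi a) (a0 : a 0%N = 1)
    (n : nat) (n_ge1 : (1 <= n)%N) :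
  let V : 'M[R[i]]_n :=
    mobiusmx (truncmx (alphamx alpha) n) (truncmx (hessmx a) n) in
  ((forall z : R[i], ratzero (phi n) z <-> eigenvalue V z) /\
   (forall z : R[i], eigenvalue V z -> \rank (eigenspace V z) = 1%N) /\
   (forall z : R[i], ratzero (phi n) z ->
      (eigenspace V z :=: \row_(k < n) rateval (phi k) z)%MS)) /\
  (exists p : {poly R[i]},
     phi n = polyrat p / polyrat (varpiprod alpha n) /\
     exists c : R[i], c != 0 /\ p = c *: char_poly V).
Proof.
have alphaD0 k : `|alpha k| < 1.
  by case: k => [|k]; [rewrite alpha0 normr0 ltr01 | exact: alphaD].
apply: (mobiusmx_orf a0 (orf_param phi_ORF) alphaD0 _ n_ge1) => k.
exact: (orf_numerators alpha0 alphaD0 phi_ORF k).1.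
Qed.
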